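(* Let $\varphi:\mathbb{N}\to\mathcal{K}$ be a map, where $\mathcal{K}$ is the set of all oriented tame knot types in $\mathbb{R}^3$. Then there is a continuous map $f:\mathbb{R}^3\to\mathbb{R}^3$ and an oriented polygonal knot $k$ in $\mathbb{R}^3$ that is iteratively injective with respect to $f$ such that $f^{n-1}(k)\in\varphi(n)$ for each $n\in\mathbb{N}$.
   Context: $\mathbb{N}$ is the set of positive integers. A knot in $\mathbb{R}^3$ is a subset homeomorphic to a circle; it is polygonal if it is a union of finitely many straight line segments. $\mathcal{K}$ denotes the set of all oriented tame knot types in $\mathbb{R}^3$, where an oriented knot type is an ambient isotopy class of oriented knots in $\mathbb{R}^3$ and it is tame if it contains a smooth or polygonal knot; an element of $K\in\mathcal{K}$ is an oriented knot. For a map $f:X\to X$, $f^0=\mathrm{id}_X$ and $f^n=f\circ f^{n-1}$ for $n\ge 1$. A subset $A\subset X$ is iteratively injective with respect to $f$ if $f^n|_A:A\to X$ is injective for every non-negative integer $n$. If $f$ is continuous and $k$ is an oriented knot that is iteratively injective with respect to $f$, each $f^n(k)$ is regarded as an oriented knot with the orientation carried over from $k$ by $f^n$. *)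

(* Defs.v *)
From HB Require Import structures.
From mathcomp Require Import all_boot all_order all_algebra.
From mathcomp Require Import all_classical all_reals all_analysis.

Set Implicit Arguments.
Unset Strict Implicit.
Unset Printing Implicit Defensive.

Import Order.TTheory GRing.Theory Num.Theory.
Import numFieldNormedType.Exports.

Local Open Scope classical_set_scope.
Local Open Scope ring_scope.

(* f is total, but only its restriction to A matters: that restriction is a
   homeomorphism from A onto B for the subspace topologies. *)
Definition homeomorphism_onto (T U : topologicalType) (A : set T) (B : set U)
    (f : T -> U) : Prop :=
  [/\ set_bij A B f, {within A, continuous f} &
      exists2 g : U -> T, {within B, continuous g} & {in A, cancel f g}].

Section Knots.
Variable R : realType.

Notation E2 := (R * R)%type.
Notation E3 := 'rV[R]_3.

Definition circle : set E2 := [set p | p.1 ^+ 2 + p.2 ^+ 2 = 1].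

Definition circle_point (t : R) : E2 := (cos t, sin t).

(* A self-homeomorphism of the circle preserves orientation when it lifts to
   an increasing map of the universal cover t |-> circle_point t. *)
Definition orientation_preserving (h : E2 -> E2) : Prop :=
  homeomorphism_onto circle circle h /\
  exists u : R -> R,
    [/\ continuous u, {homo u : s t / s < t} &
        forall t, h (circle_point t) = circle_point (u t)].

(* All parametrizations by the circle inducing the same orientation as e.
   Values off the circle are left free, so that a class only depends on the
   restriction of e to the circle. *)
Definition orientation_class (e : E2 -> E3) : set (E2 -> E3) :=
  [set e' | exists2 h, orientation_preserving h &
              {in circle, forall p, e' p = e (h p)}].

(* The data of an oriented knot: a subset of space, and an orientation, given
   as the set of the positively oriented parametrizations of that subset. The
   data form an oriented knot when is_oriented_knot below holds. *)
Record knot_data := KnotData {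
  knot_support : set E3;
  knot_orientation : set (E2 -> E3) }.

Definition is_oriented_knot (k : knot_data) : Prop :=
  exists2 e : E2 -> E3, homeomorphism_onto circle (knot_support k) e &
    knot_orientation k = orientation_class e.

(* The image of k with the orientation carried over by f; meaningful when f is
   continuous and injective on the support of k. *)
Definition knot_image (f : E3 -> E3) (k : knot_data) : knot_data :=
  KnotData (f @` knot_support k)
    [set e' | exists2 e, knot_orientation k e &
                {in circle, forall p, e' p = f (e p)}].

Definition segment (a b : E3) : set E3 :=
  [set (1 - t) *: a + t *: b | t in `[0, 1]].

Definition polygonal (k : knot_data) : Prop :=
  exists s : seq (E3 * E3),
    knot_support k = \bigcup_(p in [set` s]) segment p.1 p.2.

(* k has a positively oriented, regular, infinitely differentiable
   parametrization. *)
Definition smooth (k : knot_data) : Prop :=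
  exists2 e, knot_orientation k e &
    let c : R -> E3 := e \o circle_point in
    (forall (n : nat) (t : R), derivable (derive1n n c) t 1) /\
      (forall t, derive1 c t != 0).

Definition ambient_isotopy (H : R -> E3 -> E3) : Prop :=
  [/\ {within `[0, 1] `*` [set: E3],
         continuous (fun p : R * E3 => H p.1 p.2)},
      (forall t : R, t \in `[0, 1] ->
         homeomorphism_onto [set: E3] [set: E3] (H t)) &
      H 0 = id].

Definition ambient_isotopic (k k' : knot_data) : Prop :=
  exists2 H, ambient_isotopy H & knot_image (H 1) k = k'.

Definition oriented_knot_type (K : set knot_data) : Prop :=
  exists2 k, is_oriented_knot k &
    K = [set k' | is_oriented_knot k' /\ ambient_isotopic k k'].

Definition tame (K : set knot_data) : Prop :=
  exists2 k, K k & smooth k \/ polygonal k.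

Definition oriented_tame_knot_types : set (set knot_data) :=
  [set K | oriented_knot_type K /\ tame K].

Definition iteratively_injective (f : E3 -> E3) (A : set E3) : Prop :=
  forall n, set_inj A (iter n f).

End Knots.

(* Main.v *)
From HB Require Import structures.
Require Import Defs.
From mathcomp Require Import all_boot all_order all_algebra.
From mathcomp Require Import all_classical all_reals all_analysis.
From mathcomp Require Import ring lra.
Set Implicit Arguments.
Unset Strict Implicit.
Unset Printing Implicit Defensive.

Import Order.TTheory GRing.Theory Num.Theory.
Import numFieldNormedType.Exports.

Local Open Scope classical_set_scope.
Local Open Scope ring_scope.

(** Any sequence of knots can be visited by the iterates of one continuous map,
since nothing forces that map to be injective outside the knots. Choose for
every n an embedding e n of the circle representing the type phi n.+1, with
these knots lying in pairwise disjoint unit balls that go to infinity. On the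
support of e n the map f has to be e n.+1 o (e n)^-1, which is continuous on a
compact set; Tietze's theorem extends it, and bump functions glue these
extensions for all n into one continuous f
([extend_between_embeddings], [simultaneous_extension]). Then the n-th iterate
of f composed with e 0 is e n on the circle, which gives at once the injectivity
of the iterates on the first knot and the type, with its orientation, of each
image.

The first knot has to be polygonal, although a tame type is only known to
contain a smooth or a polygonal knot. So a smooth knot c must be shown ambient
isotopic to a polygon ([smooth_closed_curve_straightening]). Let p be the
polygon inscribed in c with a small step. The derivative of c is Lipschitz, so
p - c has a small Lipschitz constant ([polygon_error_lipschitz]). As c is
regular and simple, it is bi-Lipschitz
([regular_simple_closed_curve_expanding]), so the displacement c t |-> p t - c t
is a map from the knot to space with Lipschitz constant at most 1/2. McShane's
theorem extends it to a map psi of the whole space with the same constant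
([mcshane_extension_rV]), and x |-> x + t psi x is a homeomorphism for all t in
[0, 1] by the contraction principle ([lipschitz_ambient_isotopy]). At time 1
this isotopy has moved c onto p. *)

(** * Lipschitz maps and isotopies of space *)

(** The contraction principle needs a space that is complete and normed at once;
for matrices this joins the two structures. *)
HB.instance Definition _ (R : realType) (m n : nat) :=
  Complete.on 'M[R]_(m, n).

Lemma normr_coord_le (R : realType) n (x : 'rV[R]_n) i : `|x 0 i| <= `|x|.
Proof.
by rewrite [leRHS]/Num.Def.normr/= mx_normrE; apply: (le_bigmax _ _ (0, i)).
Qed.

Lemma normr_rV_le (R : realType) n (x : 'rV[R]_n) (c : R) :
  0 <= c -> (forall i, `|x 0 i| <= c) -> `|x| <= c.
Proof.
move=> c0 xc; rewrite [leLHS]/Num.Def.normr/= mx_normrE.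
rewrite bigmax_le//= => -[i j] _.
by rewrite (ord1 i).
Qed.

Lemma normr_rV_attained (R : realType) n (x : 'rV[R]_n) :
  x != 0 -> exists i, `|x| = `|x 0 i|.
Proof.
rewrite -normr_eq0 => /mx_norm_neq0[[i j] xij].
by exists j; rewrite [LHS]xij (ord1 i).
Qed.

Lemma lipschitz_continuous (R : realType) (V W : normedModType R) (f : V -> W)
    (L : R) : (forall p q, `|f p - f q| <= L * `|p - q|) -> continuous f.
Proof.
move=> fL x; apply/cvgrPdist_lt => e e0; near=> y.
have M0 : 0 < `|L| + 1 by rewrite ltr_pwDr.
apply: (le_lt_trans (fL _ _)).
apply: (@le_lt_trans _ _ ((`|L| + 1) * `|x - y|)).
  by rewrite ler_wpM2r// (le_trans (ler_norm _))// lerDl.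
rewrite -ltr_pdivlMl//; near: y; apply: cvgr_dist_lt => //.
by rewrite mulr_gt0 ?invr_gt0.
Unshelve. all: by end_near. Qed.

(** McShane's formula: the infimum of the cones a i + L |p - x i| is the largest
L-Lipschitz function below all of them, and the hypothesis says that the cone
of vertex x i is the lowest one at x i. The points are indexed rather than
collected in a set, so that x may repeat values: the values prescribed at equal
points then agree by hypothesis. *)
Lemma mcshane_extension (R : realType) (V : normedModType R) (I : Type)
    (i0 : I) (x : I -> V) (a : I -> R) (L : R) :
  0 <= L -> (forall i j, `|a i - a j| <= L * `|x i - x j|) ->
  exists2 u : V -> R, forall i, u (x i) = a i &
    forall p q, `|u p - u q| <= L * `|p - q|.
Proof.
move=> L0 aL.
pose S p := [set a i + L * `|p - x i| | i in [set: I]].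
have Slb p i j : a j - L * `|p - x j| <= a i + L * `|p - x i|.
  rewrite lerBlDr -addrA -lerBlDl -mulrDr.
  apply: le_trans (ler_norm _) _; apply: le_trans (aL _ _) _.
  by rewrite ler_wpM2l// [leRHS]addrC (distrC p (x j)) ler_distD.
have Sinf p : has_inf (S p).
  split; first by exists (a i0 + L * `|p - x i0|), i0.
  by exists (a i0 - L * `|p - x i0|) => _ [i _ <-].
have Sle p i : inf (S p) <= a i + L * `|p - x i|.
  by apply: (ge_inf (Sinf p).2); exists i.
have one p q : inf (S p) <= inf (S q) + L * `|p - q|.
  rewrite -lerBlDr; apply: lb_le_inf; first exact: (Sinf q).1.
  move=> _ [i _ <-]; rewrite lerBlDr; apply: le_trans (Sle p i) _.
  by rewrite -addrA lerD2l -mulrDr ler_wpM2l// [leRHS]addrC ler_distD.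
exists (fun p => inf (S p)) => [i|p q].
  apply/eqP; rewrite eq_le; apply/andP; split.
    by rewrite (le_trans (Sle _ i))// subrr normr0 mulr0 addr0.
  apply: lb_le_inf; first exact: (Sinf _).1.
  move=> _ [j _ <-]; apply: le_trans (Slb _ j i).
  by rewrite subrr normr0 mulr0 subr0.
rewrite ler_norml; apply/andP; split.
  by rewrite -(distrC q) lerNl opprB lerBlDl; exact: one.
by rewrite lerBlDl; exact: one.
Qed.

(** The norm of a row vector is the maximum of its coordinates, so extending
each coordinate separately does not increase the Lipschitz constant. *)
Lemma mcshane_extension_rV (R : realType) (V : normedModType R) n (I : Type)
    (i0 : I) (x : I -> V) (a : I -> 'rV[R]_n) (L : R) :
  0 <= L -> (forall i j, `|a i - a j| <= L * `|x i - x j|) ->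
  exists2 u : V -> 'rV[R]_n, forall i, u (x i) = a i &
    forall p q, `|u p - u q| <= L * `|p - q|.
Proof.
move=> L0 aL.
have H k : exists u : V -> R, (forall i, u (x i) = a i 0 k) /\
    forall p q, `|u p - u q| <= L * `|p - q|.
  have [|u u1 u2] := @mcshane_extension R V I i0 x (fun i => a i 0 k) L L0.
    move=> i j; apply: le_trans (aL i j).
    by have := normr_coord_le (a i - a j) k; rewrite !mxE.
  by exists u.
have [u uP] := choice H.
exists (fun p => \row_k u k p) => [i|p q].
  by apply/rowP => k; rewrite mxE (uP k).1.
apply: normr_rV_le => [|k]; first by rewrite mulr_ge0.
by rewrite !mxE; exact: (uP k).2.
Qed.

(** Solving x + phi x = y means finding a fixed point of the contraction
x |-> y - phi x. The inverse is Lipschitz because x |-> x + phi x multiplies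
distances by at least 1 - L. *)
Lemma lipschitz_perturbation_homeo (R : realType) (V : completeNormedModType R)
    (phi : V -> V) (L : R) : 0 <= L < 1 ->
  (forall p q, `|phi p - phi q| <= L * `|p - q|) ->
  exists g : V -> V, [/\ continuous g, cancel (fun x => x + phi x) g &
    cancel g (fun x => x + phi x)].
Proof.
move=> /andP[L0 L1] phiL.
have surj y : exists x, x + phi x = y.
  have fS : set_fun setT setT (fun x => y - phi x) by [].
  pose f : {fun [set: V] >-> [set: V]} := mkfun fS.
  have [|||p _ pf] := banach_fixed_point (f := f).
  - exists (NngNum L0); split => //= -[a b] _ /=.
    by rewrite opprB addrC subrKA distrC; exact: phiL.
  - exact: closedT.
  - by exists 0.
  by exists p; rewrite {1}pf /= subrK.
have [g gP] := choice surj.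
have expand p q : (1 - L) * `|p - q| <= `|(p + phi p) - (q + phi q)|.
  rewrite opprD addrACA mulrBl mul1r lerBlDr.
  apply: (@le_trans _ _ (`|p - q + (phi p - phi q)| + `|phi p - phi q|)).
    by rewrite -{1}(addrK (phi p - phi q) (p - q)); exact: ler_normB.
  by rewrite lerD2l.
have gL p q : `|g p - g q| <= (1 - L)^-1 * `|p - q|.
  by rewrite ler_pdivlMl ?subr_gt0// -{2}(gP p) -{2}(gP q).
exists g; split => //; first exact: lipschitz_continuous gL.
move=> x; apply/eqP; rewrite -subr_eq0 -normr_le0.
have := expand (g (x + phi x)) x; rewrite gP subrr normr0.
by rewrite pmulr_rle0 ?subr_gt0.
Qed.

Lemma bijective_homeomorphism_onto (T U : topologicalType) (f : T -> U)
    (g : U -> T) : continuous f -> continuous g -> cancel f g -> cancel g f ->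
  homeomorphism_onto [set: T] [set: U] f.
Proof.
move=> cf cg fg gf; split.
- split => [//|x y _ _ /(congr1 g)|y _]; first by rewrite !fg.
  by exists (g y).
- exact: continuous_subspaceT.
- exists g; first exact: continuous_subspaceT.
  by move=> x _; exact: fg.
Qed.

(** A displacement field of Lipschitz constant less than 1 can be switched on
linearly: at every intermediate time the perturbation of the identity has an
even smaller Lipschitz constant, hence is a homeomorphism. *)
Lemma lipschitz_ambient_isotopy (R : realType) (psi : 'rV[R]_3 -> 'rV[R]_3)
    (L : R) : 0 <= L < 1 ->
  (forall p q, `|psi p - psi q| <= L * `|p - q|) ->
  ambient_isotopy (fun t x => x + t *: psi x).
Proof.
move=> /andP[L0 L1] psiL.
have cpsi : continuous psi by exact: lipschitz_continuous psiL.
split.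
- apply: continuous_subspaceT => -[t x].
  apply: cvgD; first exact: cvg_snd.
  apply: cvgZ; first exact: cvg_fst.
  by apply: (@cvg_comp _ _ _ snd psi); [exact: cvg_snd|exact: cpsi].
- move=> t; rewrite in_itv/= => /andP[t0 t1].
  have tL p q : `|t *: psi p - t *: psi q| <= L * `|p - q|.
    rewrite -scalerBr normrZ ger0_norm//.
    by apply: le_trans (psiL p q); rewrite ler_piMl.
  have L01 : 0 <= L < 1 by rewrite L0.
  have [g [cg gK Kg]] := @lipschitz_perturbation_homeo R 'rV[R]_3 _ L L01 tL.
  apply: bijective_homeomorphism_onto cg gK Kg => x.
  apply: (@continuousD _ _ _ id (fun y => t *: psi y)) => //.
  by apply: (@continuousZ _ _ _ (fun=> t)); [exact: cst_continuous|exact: cpsi].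
- by apply/funext => x; rewrite scale0r addr0.
Qed.

(** * Regular closed curves *)

Lemma periodic_int (R : realType) (V : Type) (c : R -> V) (T : R) :
  (forall t, c (t + T) = c t) -> forall (k : int) t, c (t + k%:~R * T) = c t.
Proof.
move=> cT.
have cn (n : nat) t : c (t + n%:R * T) = c t.
  elim: n t => [|n IH] t; first by rewrite mul0r addr0.
  by rewrite -natr1 mulrDl mul1r addrA cT IH.
case=> n t; first exact: cn.
by rewrite NegzE -[in RHS](subrK (n.+1%:R * T) t) cn mulrNz mulNr.
Qed.

Lemma derive1_periodic (R : realType) (V : normedModType R) (c : R -> V)
    (T : R) : (forall t, c (t + T) = c t) ->
  forall t, derive1 c (t + T) = derive1 c t.
Proof.
move=> cT t; rewrite /derive1 cT.
by under eq_fun do rewrite addrA cT.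
Qed.

Lemma period_shift (R : realType) (T a t : R) : 0 < T ->
  exists k : int, a <= t + k%:~R * T < a + T.
Proof.
move=> T0; exists (- Num.floor ((t - a) / T)).
have /andP[] := floor_itv ((t - a) / T).
rewrite mulrNz mulNr ler_pdivlMr// ltr_pdivrMr// intrD => k1 k2.
by apply/andP; split; lra.
Qed.

Lemma continuous_periodic_bounded (R : realType) (V : normedModType R)
    (c : R -> V) (T : R) : 0 < T -> (forall t, c (t + T) = c t) ->
  continuous c -> exists2 M, 0 < M & forall t, `|c t| <= M.
Proof.
move=> T0 cT cc.
have [|b _ bM] := @EVT_max R (fun t => `|c t|) 0 T (ltW T0).
  by apply: continuous_subspaceT => t; apply: cvg_norm; exact: cc.
exists (`|c b| + 1) => [|t]; first by rewrite ltr_pwDr.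
have [k /andP[k0 kT]] := period_shift 0 t T0.
rewrite -(periodic_int cT k t) (le_trans (bM _ _)) ?lerDl//.
by rewrite in_itv/= k0 ltW// -[ltRHS]add0r.
Qed.

Lemma continuous_periodic_away_from0 (R : realType) (V : normedModType R)
    (c : R -> V) (T : R) : 0 < T -> (forall t, c (t + T) = c t) ->
  continuous c -> (forall t, c t != 0) ->
  exists2 m, 0 < m & forall t, m <= `|c t|.
Proof.
move=> T0 cT cc c0.
have [|b _ bM] := @EVT_min R (fun t => `|c t|) 0 T (ltW T0).
  by apply: continuous_subspaceT => t; apply: cvg_norm; exact: cc.
exists `|c b| => [|t]; first by rewrite normr_gt0.
have [k /andP[k0 kT]] := period_shift 0 t T0.
rewrite -(periodic_int cT k t) bM//.
by rewrite in_itv/= k0 ltW// -[ltRHS]add0r.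
Qed.

Lemma derivable_continuous (R : realType) (V : normedModType R) (c : R -> V) :
  (forall t, derivable c t 1) -> continuous c.
Proof.
by move=> dc t; apply: differentiable_continuous; exact/derivable1_diffP.
Qed.

Lemma mean_value (R : realType) (u : R -> R) : (forall x, derivable u x 1) ->
  forall s t, exists xi, [/\ u t - u s = derive1 u xi * (t - s),
    Num.min s t <= xi & xi <= Num.max s t].
Proof.
move=> du.
have lt s t : s <= t -> exists xi, [/\ u t - u s = derive1 u xi * (t - s),
    s <= xi & xi <= t].
  move=> st; have [||xi] := @MVT_segment R u (derive1 u) s t st.
  - by move=> x _; rewrite derive1E; exact/derivableP.
  - exact/continuous_subspaceT/derivable_continuous.
  by rewrite in_itv => /andP[? ?] ?; exists xi.
move=> s t; have [st|/ltW st] := leP s t; first exact: lt.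
have [xi [e ? ?]] := lt _ _ st; exists xi; split => //.
by rewrite -opprB e -mulrN opprB.
Qed.

Lemma derive1_coord (R : realType) n (c : R -> 'rV[R]_n) (i : 'I_n) :
  (forall t, derivable c t 1) ->
  (forall t, derivable (fun t => c t 0 i) t 1) /\
  (forall t, derive1 (fun t => c t 0 i) t = derive1 c t 0 i).
Proof.
move=> dc; split => t; first by have /derivable_mxP := dc t; exact.
by rewrite !derive1E derive_mx// mxE.
Qed.

Lemma bounded_derive1_lipschitz (R : realType) n (c : R -> 'rV[R]_n) (M : R) :
  (forall t, derivable c t 1) -> (forall t, `|derive1 c t| <= M) ->
  forall s t, `|c s - c t| <= M * `|s - t|.
Proof.
move=> dc cM s t.
have M0 : 0 <= M by exact: le_trans (cM 0).
apply: normr_rV_le => [|i]; first by rewrite mulr_ge0.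
have [di di1] := derive1_coord i dc.
have [xi [e _ _]] := mean_value di t s.
rewrite !mxE e normrM ler_wpM2r// di1.
exact: le_trans (normr_coord_le _ _) (cM xi).
Qed.

(** In the direction of the coordinate that realizes the norm of c' s, the
displacement is a value of c' nearby times the increment of the parameter, and
that value of c' differs little from c' s. *)
Lemma regular_curve_locally_expanding (R : realType) n (c : R -> 'rV[R]_n)
    (m M : R) : 0 <= M -> (forall t, derivable c t 1) ->
  (forall t, derive1 c t != 0) -> (forall t, m <= `|derive1 c t|) ->
  (forall s t, `|derive1 c s - derive1 c t| <= M * `|s - t|) ->
  forall s t, (m - M * `|t - s|) * `|t - s| <= `|c t - c s|.
Proof.
move=> M0 dc c0 cm cM s t.
have [i ci] := normr_rV_attained (c0 s).
have [di di1] := derive1_coord i dc.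
have [xi [e xi1 xi2]] := mean_value di s t.
apply: le_trans (normr_coord_le _ i).
rewrite !mxE e normrM ler_wpM2r// di1.
have : `|xi - s| <= `|t - s|.
  rewrite ler_norml; case: (leP s t) xi1 xi2 => st xi1 xi2.
    by rewrite ger0_norm; lra.
  by rewrite ltr0_norm; lra.
move=> /(ler_wpM2l M0)/(le_trans (cM xi s)).
move=> /(le_trans (normr_coord_le _ i)); rewrite !mxE => h.
have := lerB_dist (derive1 c s 0 i) (derive1 c xi 0 i).
have := cm s; rewrite ci distrC in h *; lra.
Qed.

(** A regular simple closed curve is bi-Lipschitz for the length of the shorter
arc. Parameters closer than eta are handled by regularity; the remaining
pairs form, up to a period, a compact set of pairs of distinct points, on which
the distance has a positive minimum. *)
Lemma regular_simple_closed_curve_expanding (R : realType) n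
    (c : R -> 'rV[R]_n) (T M : R) : 0 < T -> 0 < M ->
  (forall t, c (t + T) = c t) -> (forall t, derivable c t 1) ->
  (forall t, derive1 c t != 0) ->
  (forall s t, `|derive1 c s - derive1 c t| <= M * `|s - t|) ->
  (forall s t, `|t - s| <= T / 2 -> c s = c t -> s = t) ->
  exists2 mu, 0 < mu &
    forall s t, `|t - s| <= T / 2 -> mu * `|t - s| <= `|c t - c s|.
Proof.
move=> T0 M0 cT dc c0 cM cinj.
have cc := derivable_continuous dc.
have [m m0 cm] := continuous_periodic_away_from0 T0 (derive1_periodic cT)
  (lipschitz_continuous cM) c0.
(* With this eta, M * eta = m / 2: the local lower bound keeps half of m. *)
pose eta := m / (2 * M).
have eta0 : 0 < eta by rewrite divr_gt0// mulr_gt0.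
have near s t : `|t - s| <= eta -> m / 2 * `|t - s| <= `|c t - c s|.
  move=> st; apply: le_trans
    (regular_curve_locally_expanding (ltW M0) dc c0 cm cM _ _).
  rewrite ler_wpM2r//; have := ler_wpM2l (ltW M0) st.
  have -> : M * eta = m / 2 by rewrite /eta; field; rewrite lt0r_neq0.
  lra.
have [etaT|etaT] := ltP (T / 2) eta.
  exists (m / 2) => [|s t st]; first by rewrite divr_gt0.
  by apply: near; rewrite (le_trans st)// ltW.
(* A pair of parameters is encoded as a start and a positive increment. *)
pose K := `[0, T]%classic `*` `[eta, T / 2]%classic : set (R * R).
have [|||b] := @compact_EVT_min (R * R)%type R
    (fun x => `|c (x.1 + x.2) - c x.1|) K.
- by exists (0, eta); split; rewrite /= in_itv/= lexx// ltW.
- by apply: compact_setX; exact: segment_compact.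
- apply: continuous_subspaceT => x; apply: cvg_norm; apply: cvgB.
    apply: (@cvg_comp _ _ _ (fun y : R * R => y.1 + y.2) c); last exact: cc.
    by apply: cvgD; [exact: cvg_fst|exact: cvg_snd].
  by apply: (@cvg_comp _ _ _ fst c); [exact: cvg_fst|exact: cc].
rewrite inE => -[_ /=]; rewrite in_itv/= => /andP[b1 b2] bmin.
set nu := `|_| in bmin.
have nu0 : 0 < nu.
  rewrite normr_gt0 subr_eq0; apply/eqP => e.
  have b2p : 0 < b.2 by exact: lt_le_trans b1.
  have := cinj b.1 (b.1 + b.2).
  rewrite addrAC subrr add0r gtr0_norm// => /(_ b2 (esym e)).
  by move=> /eqP; rewrite eq_sym -subr_eq0 addrAC subrr add0r gt_eqF.
have far s t : eta <= t - s <= T / 2 -> nu <= `|c t - c s|.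
  move=> st; have [k /andP[k0 kT]] := period_shift 0 s T0.
  have inK : K (s + k%:~R * T, t - s).
    split; rewrite /= in_itv/= ?st// k0 ltW//.
    by rewrite -[ltRHS]add0r.
  have := bmin _ (mem_set inK); rewrite /=.
  by rewrite addrAC (addrC s) subrK !(periodic_int cT).
have far' s t : eta <= `|t - s| <= T / 2 -> nu <= `|c t - c s|.
  have [st|st] := leP s t; first by rewrite ger0_norm ?subr_ge0//; exact: far.
  by rewrite distrC gtr0_norm ?subr_gt0// distrC; exact: far.
exists (Num.min (m / 2) (nu / T)) => [|s t st].
  by rewrite lt_min !divr_gt0.
have [lte|lte] := leP `|t - s| eta.
  by apply: le_trans (near _ _ lte); rewrite ler_wpM2r// ge_min lexx.
apply: le_trans (far' s t _); last by rewrite ltW.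
apply: (@le_trans _ _ (nu / T * `|t - s|)).
  by rewrite ler_wpM2r// ge_min lexx orbT.
by rewrite mulrAC ler_pdivrMr// ler_wpM2l ?(ltW nu0)//; lra.
Qed.

(** * Inscribed polygons *)

Definition chord (R : realType) (V : normedModType R) (c : R -> V)
  (h a t : R) : V := c a + ((t - a) / h) *: (c (a + h) - c a).

Definition grid_point (R : realType) (h t : R) : R :=
  (Num.floor (t / h))%:~R * h.

Definition inscribed_polygon (R : realType) (V : normedModType R)
  (c : R -> V) (h t : R) : V := chord c h (grid_point h t) t.

Lemma grid_point_itv (R : realType) (h t : R) : 0 < h ->
  grid_point h t <= t < grid_point h t + h.
Proof.
move=> h0; have /andP[] := floor_itv (t / h).
by rewrite ler_pdivlMr// ltr_pdivrMr// intrD mulrDl mul1r => -> ->.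
Qed.

Lemma grid_point_next (R : realType) (h s t : R) : 0 < h -> s <= t ->
  grid_point h s = grid_point h t \/ grid_point h s + h <= grid_point h t.
Proof.
move=> h0 st; have : (Num.floor (s / h) <= Num.floor (t / h))%R.
  by rewrite le_floor// ler_pM2r// invr_gt0.
rewrite le_eqVlt => /orP[/eqP e|]; first by left; rewrite /grid_point e.
rewrite -lezD1 -(ler_int R) => e; right.
by rewrite -[X in _ + X]mul1r -mulrDl ler_pM2r// (le_trans _ e)// intrD.
Qed.

Lemma grid_point_eq (R : realType) (h t : R) (k : int) : 0 < h ->
  k%:~R * h <= t < k%:~R * h + h -> grid_point h t = k%:~R * h.
Proof.
move=> h0 /andP[k1 k2]; congr (_%:~R * _); apply: floor_def.
by rewrite ler_pdivlMr// ltr_pdivrMr// k1 intrD mulrDl mul1r.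
Qed.

Lemma chord_start (R : realType) (V : normedModType R) (c : R -> V) (h a : R) :
  chord c h a a = c a.
Proof. by rewrite /chord subrr mul0r scale0r addr0. Qed.

Lemma chord_end (R : realType) (V : normedModType R) (c : R -> V) (h a : R) :
  h != 0 -> chord c h a (a + h) = c (a + h).
Proof.
by move=> h0; rewrite /chord addrAC subrr add0r divff// scale1r addrC subrK.
Qed.

(** In each coordinate, the slope of the chord and the slope of c between s and
t are both values of the derivative in the same cell of length h, so they
differ by at most M h. *)
Lemma chord_error_lipschitz (R : realType) n (c : R -> 'rV[R]_n) (h M a : R) :
  0 < h -> 0 <= M -> (forall t, derivable c t 1) ->
  (forall s t, `|derive1 c s - derive1 c t| <= M * `|s - t|) ->
  forall s t, a <= s -> s <= t -> t <= a + h ->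
    `|(chord c h a t - c t) - (chord c h a s - c s)| <= M * h * (t - s).
Proof.
move=> h0 M0 dc cM s t as_ st tah.
apply: normr_rV_le => [|i]; first by rewrite !mulr_ge0// ?subr_ge0// ltW.
have [di di1] := derive1_coord i dc.
have [xi [e1 xi1 xi2]] := mean_value di a (a + h).
have [et [e2 et1 et2]] := mean_value di s t.
rewrite di1 (addrAC a) subrr add0r in e1; rewrite di1 in e2.
rewrite min_l ?max_r ?lerDl ?(ltW h0)// in xi1 xi2.
rewrite min_l ?max_r// in et1 et2.
have -> : ((chord c h a t - c t) - (chord c h a s - c s)) 0 i =
    (derive1 c xi - derive1 c et) 0 i * (t - s).
  rewrite !mxE e1.
  have -> : (derive1 c xi 0 i - derive1 c et 0 i) * (t - s) =
      derive1 c xi 0 i * (t - s) - (c t 0 i - c s 0 i).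
    by rewrite e2 mulrBl.
  by field; rewrite gt_eqF.
rewrite normrM [X in _ * X]ger0_norm ?subr_ge0// ler_wpM2r ?subr_ge0//.
apply: le_trans (normr_coord_le _ _) _; apply: le_trans (cM _ _) _.
by rewrite ler_wpM2l// ler_norml; apply/andP; split; lra.
Qed.

(** The error vanishes at all grid points. For two parameters in different
cells it therefore suffices to compare each of them with a grid point lying
between them. *)
Lemma polygon_error_lipschitz (R : realType) n (c : R -> 'rV[R]_n) (h M : R) :
  0 < h -> 0 <= M -> (forall t, derivable c t 1) ->
  (forall s t, `|derive1 c s - derive1 c t| <= M * `|s - t|) ->
  let d t := inscribed_polygon c h t - c t in
  forall s t, `|d t - d s| <= M * h * `|t - s|.
Proof.
move=> h0 M0 dc cM d.
have lt s t : s <= t -> `|d t - d s| <= M * h * (t - s).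
  move=> st; have /andP[s1 s2] := grid_point_itv s h0.
  have /andP[t1 t2] := grid_point_itv t h0.
  have [e|e] := grid_point_next h0 st.
    rewrite /d /inscribed_polygon e.
    apply: (chord_error_lipschitz h0 M0 dc cM) => //; last exact: ltW.
    by rewrite -e.
  have ht := chord_error_lipschitz h0 M0 dc cM (lexx _) t1 (ltW t2).
  have hs := chord_error_lipschitz h0 M0 dc cM s1 (ltW s2) (lexx _).
  rewrite chord_start subrr subr0 in ht.
  rewrite chord_end ?gt_eqF// subrr sub0r normrN in hs.
  apply: le_trans (ler_normB _ _) _; apply: le_trans (lerD ht hs) _.
  by rewrite -mulrDr ler_wpM2l ?mulr_ge0 ?(ltW h0)//; lra.
move=> s t; have [st|/ltW st] := leP s t.
  by rewrite ger0_norm ?subr_ge0//; exact: lt.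
by rewrite distrC (distrC t) ger0_norm ?subr_ge0//; exact: lt.
Qed.

Lemma inscribed_polygon_periodic (R : realType) (V : normedModType R)
    (c : R -> V) (h : R) (N : nat) : 0 < h ->
  (forall t, c (t + N%:R * h) = c t) ->
  forall t, inscribed_polygon c h (t + N%:R * h) = inscribed_polygon c h t.
Proof.
move=> h0 cT t; rewrite /inscribed_polygon.
have -> : grid_point h (t + N%:R * h) = grid_point h t + N%:R * h.
  rewrite {2}/grid_point -mulrDl -[N%:R]/((N%:Z)%:~R) -intrD.
  apply: grid_point_eq => //.
  have /andP[t1 t2] := grid_point_itv t h0; move: t1 t2; rewrite /grid_point.
  by rewrite intrD mulrDl => t1 t2; apply/andP; split; lra.
rewrite /chord [grid_point h t + _ + h]addrAC !cT.
by rewrite opprD addrACA subrr addr0.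
Qed.

Lemma affine_combE (R : realType) (V : normedModType R) (a b : V) (r : R) :
  (1 - r) *: a + r *: b = a + r *: (b - a).
Proof. by rewrite scalerBl scale1r scalerBr -addrA (addrC (- _)). Qed.

(** One period is covered by the first N cells. An end point of a cell is
reached at the start of the next cell, because cells are half open. *)
Lemma inscribed_polygon_image (R : realType) (c : R -> 'rV[R]_3) (h : R)
    (N : nat) : 0 < h -> (0 < N)%N -> (forall t, c (t + N%:R * h) = c t) ->
  range (inscribed_polygon c h) =
  \bigcup_(p in [set` [seq (c (i%:R * h), c (i%:R * h + h)) | i <- iota 0 N]])
    segment p.1 p.2.
Proof.
move=> h0 N0 cT; apply/seteqP; split => [_ [t _ <-]|x].
  have T0 : 0 < N%:R * h by rewrite mulr_gt0// ltr0n.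
  have [k /andP[t0 tT]] := period_shift 0 t T0.
  rewrite -(periodic_int (inscribed_polygon_periodic h0 cT) k).
  move: (t + _) t0 tT => {k}t t0; rewrite add0r => tT.
  have th0 : 0 <= t / h by rewrite divr_ge0// ltW.
  have fl0 : 0 <= Num.floor (t / h) by rewrite floor_ge0.
  set i := `|Num.floor (t / h)|%N.
  have iE : grid_point h t = i%:R * h.
    by rewrite /grid_point /i -[in LHS](gez0_abs fl0).
  have /andP[t1 t2] := grid_point_itv t h0; rewrite iE in t1 t2.
  have iN : (i < N)%N.
    by rewrite -(ltr_nat R) -(ltr_pM2r h0) (le_lt_trans t1).
  exists (c (i%:R * h), c (i%:R * h + h)) => /=.
    by apply/mapP; exists i; rewrite ?mem_iota.
  exists ((t - i%:R * h) / h).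
    rewrite /= in_itv/= divr_ge0 ?subr_ge0 ?(ltW h0)//=.
    by rewrite ler_pdivrMr// mul1r lerBlDl addrC ltW// addrC.
  by rewrite /inscribed_polygon /chord iE affine_combE.
move=> [_ /= /mapP[i _ ->]] [r] /=; rewrite in_itv/= => /andP[r0 r1] <-.
have [->|rn1] := eqVneq r 1.
  exists (i%:R * h + h) => //; rewrite /inscribed_polygon.
  rewrite (_ : grid_point _ _ = i%:R * h + h) ?chord_start.
    by rewrite subrr scale0r scale1r add0r.
  have -> : i%:R * h + h = (i.+1%:Z)%:~R * h.
    by rewrite -[_%:~R]/(i.+1%:R) -natr1 mulrDl mul1r.
  by apply: grid_point_eq => //; rewrite lexx ltrDl.
exists (i%:R * h + r * h) => //; rewrite /inscribed_polygon.
rewrite (_ : grid_point _ _ = i%:R * h).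
  by rewrite /chord affine_combE addrAC subrr add0r mulfK ?gt_eqF.
rewrite -[i%:R]/((i%:Z)%:~R); apply: grid_point_eq => //.
by rewrite lerDl mulr_ge0 ?(ltW h0)//= ltrD2l gtr_pMl// lt_neqAle rn1.
Qed.

(** The displacement from the curve to an inscribed polygon has a Lipschitz
constant proportional to the step of the polygon with respect to the parameter,
hence also with respect to the position in space, since the curve is
bi-Lipschitz. For a fine polygon it extends to a displacement field of space
with constant 1/2, which can be switched on by an isotopy. At its end the curve
lies exactly on the polygon. *)
Lemma smooth_closed_curve_straightening (R : realType) (c : R -> 'rV[R]_3)
    (T : R) : 0 < T -> (forall t, c (t + T) = c t) ->
  (forall t, derivable c t 1) -> (forall t, derivable (derive1 c) t 1) ->
  continuous (derive1 (derive1 c)) -> (forall t, derive1 c t != 0) ->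
  (forall s t, `|t - s| <= T / 2 -> c s = c t -> s = t) ->
  exists H, ambient_isotopy H /\
    exists s : seq ('rV[R]_3 * 'rV[R]_3),
      H 1 @` range c = \bigcup_(p in [set` s]) segment p.1 p.2.
Proof.
move=> T0 cT dc ddc c2 c0 cinj.
have [M M0 cM] := continuous_periodic_bounded T0
  (derive1_periodic (derive1_periodic cT)) c2.
have lipc' := bounded_derive1_lipschitz ddc cM.
have [mu mu0 expand] :=
  regular_simple_closed_curve_expanding T0 M0 cT dc c0 lipc' cinj.
(* The error constant M * h divided by mu has to be at most 1/2. *)
pose N := (Num.truncn (2 * M * T / mu)).+1.
pose h := T / N%:R.
have N0 : 0 < N%:R :> R by rewrite ltr0n.
have h0 : 0 < h by rewrite divr_gt0.
have Nh : N%:R * h = T by rewrite mulrC divfK// gt_eqF.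
have small : M * h <= 2^-1 * mu.
  rewrite /h mulrA ler_pdivrMr//.
  have : 2 * M * T / mu < N%:R by exact: truncnS_gt.
  by rewrite ltr_pdivrMr//; lra.
have cT' t : c (t + N%:R * h) = c t by rewrite Nh.
have pT := inscribed_polygon_periodic h0 cT'.
have dlip := polygon_error_lipschitz h0 (ltW M0) dc lipc'.
pose d t := inscribed_polygon c h t - c t.
have dT (k : int) t : d (t + k%:~R * T) = d t.
  by rewrite /d -Nh (periodic_int pT) (periodic_int cT').
have dc_lip s t : `|d s - d t| <= 2^-1 * `|c s - c t|.
  have [k /andP[k1 k2]] := period_shift (t - T / 2) s T0.
  rewrite -(dT k) -(periodic_int cT k s).
  move: (s + _) k1 k2 => {k}s s1 s2.
  have st : `|s - t| <= T / 2 by rewrite ler_norml; lra.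
  apply: le_trans (dlip _ _) _.
  apply: (@le_trans _ _ (2^-1 * mu * `|s - t|)); first by rewrite ler_wpM2r.
  by rewrite -mulrA ler_wpM2l ?invr_ge0//; exact: expand.
have half0 : 0 <= 2^-1 :> R by rewrite invr_ge0.
have [psi psic psiL] := mcshane_extension_rV 0 half0 dc_lip.
exists (fun t x => x + t *: psi x); split.
  by apply: lipschitz_ambient_isotopy psiL; lra.
exists [seq (c (i%:R * h), c (i%:R * h + h)) | i <- iota 0 N].
rewrite -(inscribed_polygon_image h0 _ cT')// image_comp; congr (_ @` _).
by apply/funext => t /=; rewrite scale1r psic /d addrC subrK.
Qed.

(** * The circle and oriented knots *)

Lemma circle_point_circle (R : realType) (t : R) : circle (circle_point t).
Proof. exact: cos2Dsin2. Qed.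

Lemma circle_point_continuous (R : realType) : continuous (@circle_point R).
Proof.
move=> t; exact: (cvg_pair (@continuous_cos R t) (@continuous_sin R t)).
Qed.

Lemma circle_pointP (R : realType) (p : R * R) : circle p ->
  exists2 t, -pi <= t <= pi & circle_point t = p.
Proof.
case: p => x y; rewrite /circle/= => xy.
have x1 : -1 <= x <= 1.
  rewrite -ler_norml -(@expr_le1 _ 2)// real_normK ?num_real//.
  by rewrite -xy lerDl sqr_ge0.
have [/andP[a0 api] ca] := acos_def x1.
have sa : Num.sqrt (1 - x ^+ 2) = `|y|.
  by rewrite -xy addrAC subrr add0r sqrtr_sqr.
have [y0|y0] := leP 0 y.
  exists (acos x).
    by rewrite api andbT (le_trans _ a0)// oppr_le0 pi_ge0.
  by rewrite /circle_point ca sin_acos// sa ger0_norm.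
exists (- acos x).
  by rewrite lerN2 api/= (le_trans _ (pi_ge0 R))// oppr_le0.
by rewrite /circle_point cosN sinN ca sin_acos// sa ltr0_norm// opprK.
Qed.

Lemma circle_compact (R : realType) : compact (@circle R).
Proof.
have -> : @circle R = @circle_point R @` `[-pi, pi]%classic.
  apply/seteqP; split => [p /circle_pointP[t tpi <-]|_ [t _ <-]].
    by exists t.
  exact: circle_point_circle.
apply: continuous_compact; last exact: segment_compact.
exact/continuous_subspaceT/circle_point_continuous.
Qed.

Lemma circle_point_inj (R : realType) (s t : R) : `|t - s| <= pi ->
  circle_point s = circle_point t -> s = t.
Proof.
move=> stpi [cst sst].
have : cos `|t - s| = cos 0.
  by rewrite cos_norm cosB -cst -sst -!expr2 cos2Dsin2 cos0.
move=> /cos_inj; rewrite !in_itv/= lexx pi_ge0 normr_ge0 stpi => /(_ isT isT).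
by move=> /eqP; rewrite normr_eq0 subr_eq0 => /eqP.
Qed.

Lemma circle_point_periodic (R : realType) (t : R) :
  circle_point (t + pi *+ 2) = circle_point t.
Proof. by rewrite /circle_point cosD2pi sinD2pi. Qed.

Lemma within_continuous_composition (T U V : topologicalType) (A : set T)
    (B : set U) (f : T -> U) (g : U -> V) : {homo f : x / A x >-> B x} ->
  {within A, continuous f} -> {within B, continuous g} ->
  {within A, continuous (g \o f)}.
Proof.
move=> fAB /subspace_continuousP cf /subspace_continuousP cg.
apply/subspace_continuousP => x Ax.
apply: (@cvg_comp _ _ _ f g _ (within B (nbhs (f x)))); last exact/cg/fAB.
move=> S BS; have : nbhs x [set y | A y -> B (f y) -> S (f y)] := cf x Ax _ BS.
by move=> H; suff : nbhs x [set y | A y -> S (f y)] by [];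
  apply: filterS H => y ABS Ay; exact: ABS (fAB _ Ay).
Qed.

Lemma homeomorphism_onto_comp (T U V : topologicalType) (A : set T)
    (B : set U) (C : set V) (f : T -> U) (g : U -> V) :
  homeomorphism_onto A B f -> homeomorphism_onto B C g ->
  homeomorphism_onto A C (g \o f).
Proof.
move=> [fAB cf [f' cf' fK]] [gBC cg [g' cg' gK]].
have [fA fI fS] := fAB; have [gB gI gS] := gBC.
have C_B y : C y -> B (g' y).
  by move=> /gS[x Bx <-]; rewrite gK// inE.
split; first exact: set_bij_comp gBC.
- exact: within_continuous_composition cg.
- exists (f' \o g'); first exact: within_continuous_composition cf'.
  move=> x Ax /=; rewrite gK; first exact: fK.
  by rewrite inE; apply: fA; rewrite inE in Ax.
Qed.

(** Every oriented knot has this form for some embedding, which allows one to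
compute with embeddings: the image of a knot becomes a composition. *)
Definition knot_of (R : realType) (e : R * R -> 'rV[R]_3) : knot_data R :=
  KnotData (e @` @circle R) (orientation_class e).

Definition circle_embedding (R : realType) (e : R * R -> 'rV[R]_3) : Prop :=
  homeomorphism_onto (@circle R) (e @` @circle R) e.

Lemma is_oriented_knotP (R : realType) (k : knot_data R) :
  is_oriented_knot k <-> exists2 e, circle_embedding e & k = knot_of e.
Proof.
split=> [[e he ke]|[e he ->]]; last by exists e.
have se : e @` @circle R = knot_support k.
  have [[h1 h2 h3] _ _] := he.
  by apply/seteqP; split => // _ [x Cx <-]; exact: h1.
exists e; first by rewrite /circle_embedding se.
by case: k se ke {he} => S O /= <- ->.
Qed.

Lemma knot_of_ext (R : realType) (e e' : R * R -> 'rV[R]_3) :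
  {in @circle R, e =1 e'} -> knot_of e = knot_of e'.
Proof.
move=> ee'; congr KnotData.
  by apply: eq_imagel => x Cx; apply: ee'; rewrite inE.
apply/seteqP; split => d [h hP de]; exists h => // p Cp; rewrite de// ee'//;
  by have [[[hC _ _] _ _] _] := hP; rewrite inE; apply: hC; rewrite inE in Cp.
Qed.

Lemma knot_image_of (R : realType) (f : 'rV[R]_3 -> 'rV[R]_3)
    (e : R * R -> 'rV[R]_3) : knot_image f (knot_of e) = knot_of (f \o e).
Proof.
congr KnotData; first by rewrite /= image_comp.
apply/seteqP; split => d /=.
  by move=> [e' [h hP e'h] dfe]; exists h => // p Cp; rewrite dfe// e'h.
move=> [h hP dh]; exists (e \o h); first by exists h.
by move=> p Cp; rewrite dh.
Qed.

Lemma circle_embedding_comp (R : realType) (f : 'rV[R]_3 -> 'rV[R]_3)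
    (e : R * R -> 'rV[R]_3) : circle_embedding e ->
  homeomorphism_onto setT setT f -> circle_embedding (f \o e).
Proof.
move=> he [[_ fI _] cf [g cg fK]]; apply: homeomorphism_onto_comp he _.
rewrite -image_comp; split.
- split => [x Ax|x y _ _|x //]; first by exists x.
  by apply: fI; rewrite inE.
- exact: continuous_subspaceW cf.
- exists g; first exact: continuous_subspaceW cg.
  by move=> x _; apply: fK; rewrite inE.
Qed.

Lemma ambient_isotopic_trans (R : realType) (k1 k2 k3 : knot_data R) :
  is_oriented_knot k1 ->
  ambient_isotopic k1 k2 -> ambient_isotopic k2 k3 -> ambient_isotopic k1 k3.
Proof.
move=> /is_oriented_knotP[e _ ->] [H HP <-] [K KP <-].
exists (fun t => K t \o H t); last by rewrite !knot_image_of.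
have [cH hH H0] := HP; have [cK hK K0] := KP; split.
- pose F (p : R * 'rV[R]_3) := (p.1, H p.1 p.2).
  pose G (p : R * 'rV[R]_3) := K p.1 p.2.
  change {within `[0, 1] `*` [set: 'rV[R]_3], continuous (G \o F)}.
  apply: within_continuous_composition cK; first by move=> x [].
  apply/subspace_continuousP => x Ax.
  have c1 : p.1 @[p --> within (`[0, 1] `*` [set: 'rV[R]_3]) (nbhs x)] --> x.1.
    by apply: cvg_within_filter; exact: cvg_fst.
  by move/subspace_continuousP: cH => /(_ x Ax) c2; exact: (cvg_pair c1 c2).
- by move=> t t01; apply: homeomorphism_onto_comp (hH t t01) (hK t t01).
- by rewrite H0 K0.
Qed.

Lemma ambient_isotopy_end_embedding (R : realType)
    (H : R -> 'rV[R]_3 -> 'rV[R]_3) (e : R * R -> 'rV[R]_3) :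
  ambient_isotopy H -> circle_embedding e -> circle_embedding (H 1 \o e).
Proof.
move=> [_ hH _] he; apply: circle_embedding_comp => //.
by apply: hH; rewrite in_itv/= ler01 lexx.
Qed.

(** * Polygonal representatives of tame knot types *)

Lemma affine_continuous (R : realType) (V : normedModType R) (a : R) (w : V) :
  continuous (fun x => a *: x + w).
Proof.
apply: (@lipschitz_continuous _ _ _ _ `|a|) => p q.
by rewrite opprD addrACA subrr addr0 -scalerBr normrZ.
Qed.

Lemma similarity_isotopy (R : realType) (r : R) (v : 'rV[R]_3) : 0 < r ->
  exists2 H, ambient_isotopy H & H 1 = (fun x => r *: x + v).
Proof.
move=> r0; exists (fun t x => (1 - t + t * r) *: x + t *: v); last first.
  by apply/funext => x; rewrite subrr add0r mul1r scale1r.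
split.
- apply: continuous_subspaceT => -[t x].
  have c1 : {for (t, x), continuous (fun p : R * 'rV[R]_3 => p.1)}.
    exact: cvg_fst.
  have c2 : {for (t, x), continuous (fun p : R * 'rV[R]_3 => p.2)}.
    exact: cvg_snd.
  apply: cvgD; apply: cvgZ => //; last exact: cvg_cst.
  apply: cvgD; last by apply: cvgM => //; exact: cvg_cst.
  by apply: cvgB => //; exact: cvg_cst.
- move=> t; rewrite in_itv/= => /andP[t0 t1].
  have : 0 < 1 - t + t * r.
    have [->|tn0] := eqVneq t 0; first by rewrite subr0 mul0r addr0.
    by rewrite ltr_wpDl ?subr_ge0// mulr_gt0// lt_neqAle eq_sym tn0.
  move: (1 - t + t * r) => a a0.
  apply: (@bijective_homeomorphism_onto _ _ _
    (fun y => a^-1 *: y - a^-1 *: (t *: v))).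
  + exact: affine_continuous.
  + exact: affine_continuous.
  + by move=> x; rewrite -scalerBr addrK scalerA mulVf ?gt_eqF// scale1r.
  + by move=> x; rewrite -scalerBr scalerA mulfV ?gt_eqF// scale1r subrK.
- by apply/funext => x; rewrite subr0 mul0r addr0 scale1r scale0r addr0.
Qed.

Lemma polygonal_similarity (R : realType) (e : R * R -> 'rV[R]_3) (r : R)
    (v : 'rV[R]_3) :
  polygonal (knot_of e) -> polygonal (knot_of ((fun x => r *: x + v) \o e)).
Proof.
move=> [s es]; exists [seq (r *: p.1 + v, r *: p.2 + v) | p <- s].
have E (a b : 'rV[R]_3) t : (1 - t) *: (r *: a + v) + t *: (r *: b + v) =
    r *: ((1 - t) *: a + t *: b) + v.
  rewrite !scalerDr addrACA -scalerDl subrK scale1r !scalerA.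
  by rewrite (mulrC _ r) (mulrC t).
rewrite /knot_of/= -image_comp [e @` _]es; apply/seteqP; split.
  move=> _ [_ [[a b] /= abs [t t01 <-]] <-].
  exists (r *: a + v, r *: b + v) => /=; first by apply/mapP; exists (a, b).
  by exists t.
move=> _ [_ /= /mapP[[a b] abs ->] [t t01 <-]] /=.
exists ((1 - t) *: a + t *: b); last by rewrite E.
by exists (a, b) => //; exists t.
Qed.

(** A positively oriented smooth parametrization, read on the universal cover of
the circle, is a regular simple closed curve of period 2 pi. Only the supports
have to be compared: the orientation is carried along by the isotopy. *)
Lemma smooth_isotopic_polygonal (R : realType) (k : knot_data R) :
  is_oriented_knot k -> smooth k ->
  exists2 H, ambient_isotopy H & polygonal (knot_image (H 1) k).
Proof.
move=> /is_oriented_knotP[e0 he0 ->] [e [h hP eh] /= [de d0]].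
have [[[hC hI hS] _ _] _] := hP; have [[_ e0I _] _ _] := he0.
have pi20 : 0 < pi *+ 2 :> R by rewrite mulrn_wgt0// pi_gt0.
have [||||||H [HH [s Hs]]] :=
    @smooth_closed_curve_straightening R (e \o @circle_point R) _ pi20.
- by move=> t; rewrite /= circle_point_periodic.
- exact: (de 0).
- exact: (de 1).
- exact: derivable_continuous (de 2).
- exact: d0.
- move=> u t; rewrite -[_ *+ 2]mulr_natr mulfK ?pnatr_eq0// => ut /=.
  rewrite !eh ?inE; [|exact: circle_point_circle..].
  have [Cu Ct] := (circle_point_circle u, circle_point_circle t).
  move=> /e0I; rewrite !inE => /(_ (hC _ Cu) (hC _ Ct)).
  move=> /hI; rewrite !inE => /(_ Cu Ct).
  exact: circle_point_inj.
exists H => //; exists s; rewrite -Hs.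
change (H 1 @` (e0 @` @circle R) = H 1 @` range (e \o @circle_point R)).
congr (_ @` _); apply/seteqP; split => [_ [p Cp <-]|_ [t _ <-]].
  have [q Cq <-] := hS p Cp; have [t _ tq] := circle_pointP Cq.
  by exists t => //=; rewrite tq eh// inE.
exists (h (circle_point t)); first exact/hC/circle_point_circle.
by rewrite /= eh// inE; exact: circle_point_circle.
Qed.

Lemma embedding_bounded (R : realType) (e : R * R -> 'rV[R]_3) :
  circle_embedding e -> exists2 M, 0 < M & forall p, circle p -> `|e p| <= M.
Proof.
move=> [_ ce _].
have : compact (e @` @circle R).
  by apply: continuous_compact => //; exact: circle_compact.
move=> /compact_bounded/ex_strict_bound_gt0[M M0 eM]; exists M => // p Cp.
by apply/ltW/eM; exists p.
Qed.

(** After straightening a smooth representative, a homothety makes the knot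
small and a translation puts it where it is wanted; both are isotopic to the
identity and preserve polygons. *)
Lemma tame_knot_type_representative (R : realType) (K : set (knot_data R))
    (v : 'rV[R]_3) : oriented_tame_knot_types K ->
  exists e : R * R -> 'rV[R]_3, [/\ circle_embedding e, polygonal (knot_of e),
    K (knot_of e) & forall p, circle p -> `|e p - v| <= 1].
Proof.
move=> [[k0 k0P ->] [k [kP k0k] kt]].
have [e [he pe k0e]] : exists e, [/\ circle_embedding e,
    polygonal (knot_of e) & ambient_isotopic k0 (knot_of e)].
  move: kP kt k0k => /is_oriented_knotP[e he ->] [sm|po] k0k; last by exists e.
  have [|H HP pH] := smooth_isotopic_polygonal _ sm.
    by apply/is_oriented_knotP; exists e.
  exists (H 1 \o e); rewrite -knot_image_of; split => //.
    exact: ambient_isotopy_end_embedding.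
  by apply: ambient_isotopic_trans k0k _ => //; exists H.
have [M M0 eM] := embedding_bounded he.
have Mi0 : 0 < M^-1 by rewrite invr_gt0.
have [H HP H1] := similarity_isotopy v Mi0.
exists ((fun x => M^-1 *: x + v) \o e); split.
- by have := ambient_isotopy_end_embedding HP he; rewrite H1.
- exact: polygonal_similarity.
- split.
    apply/is_oriented_knotP; eexists; last by [].
    by have := ambient_isotopy_end_embedding HP he; rewrite H1.
  apply: ambient_isotopic_trans k0P k0e _.
  by exists H; rewrite ?H1 ?knot_image_of.
- move=> p Cp /=; rewrite addrK normrZ gtr0_norm// mulrC ler_pdivrMr// mul1r.
  exact: eM.
Qed.

(** * A self-map of space with prescribed values on a sequence of knots *)

Lemma row_continuous (R : realType) (V : normedModType R) n
    (g : 'I_n -> V -> R) : (forall i, continuous (g i)) ->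
  continuous (fun x => \row_i g i x).
Proof.
move=> cg x; apply/cvgrPdist_le => eps eps0; near=> y.
apply: normr_rV_le => [|i]; first exact: ltW.
rewrite !mxE; move: i; near: y; apply: filter_forall => i.
by have /cvgrPdist_le := cg i x; exact.
Unshelve. all: by end_near. Qed.

(** The map e' o e^-1 is continuous on the compact support of the first knot, so
its coordinates extend by Tietze's theorem. *)
Lemma extend_between_embeddings (R : realType) (e e' : R * R -> 'rV[R]_3) :
  circle_embedding e -> circle_embedding e' ->
  exists2 g : 'rV[R]_3 -> 'rV[R]_3, continuous g &
    forall p, circle p -> g (e p) = e' p.
Proof.
move=> he he'; have [_ ce [w cw ew]] := he.
have [M M0 eM] := embedding_bounded he'.
set A := e @` @circle R in cw.
have clA : closed A.
  apply: compact_closed; first exact: norm_hausdorff.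
  by apply: continuous_compact => //; exact: circle_compact.
have wA x : A x -> circle (w x) by move=> [p Cp <-]; rewrite ew// inE.
have [_ ce' _] := he'.
have cew : {within A, continuous (e' \o w)}.
  exact: within_continuous_composition ce'.
have Hi i : exists g : 'rV[R]_3 -> R, continuous g /\
    forall x, A x -> g x = e' (w x) 0 i.
  have [||g [gE cg _]] := @continuous_bounded_extension 'rV[R]_3 R
    (@pseudometric_normal R 'rV[R]_3) A clA (fun x => e' (w x) 0 i) M M0.
  - apply: (@within_continuous_comp _ _ _ A (e' \o w)
      (fun x : 'rV[R]_3 => x 0 i)) => //.
    by move=> x _; exact: coord_continuous.
  - by move=> x Ax; apply: le_trans (normr_coord_le _ _) _; exact/eM/wA.
  by exists g; split => // x Ax; rewrite -gE// inE.
have [g gP] := choice Hi.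
exists (fun x => \row_i g i x) => [|p Cp].
  exact: row_continuous (fun i => (gP i).1).
apply/rowP => i; rewrite mxE (gP i).2; last by exists p.
by rewrite ew// inE.
Qed.

(** The series over all n has at each point only finitely many nonzero terms;
its partial sum up to the integer part of the norm is already its total. *)
Lemma locally_finite_sum_stable (R : realType) (V W : normedModType R)
    (F : nat -> V -> W) :
  (forall n z, `|z| < n%:R -> F n z = 0) ->
  forall z K, `|z| < K%:R ->
    \sum_(i < (Num.truncn `|z|).+1) F i z = \sum_(i < K) F i z.
Proof.
move=> F0 z K zK.
have tK : ((Num.truncn `|z|).+1 <= K)%N by rewrite truncn_lt_nat.
rewrite (big_ord_widen K (fun i => F i z) tK) big_mkcond/=.
apply: eq_bigr => i _; case: ifPn => //; rewrite -leqNgt => ti.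
rewrite F0//; apply: lt_le_trans (truncnS_gt _) _.
by rewrite ler_nat.
Qed.

(** On the ball of radius |z| + 1 around the origin, which is a neighbourhood of
z, the number of terms can be taken constant. *)
Lemma locally_finite_sum_continuous (R : realType) (V W : normedModType R)
    (F : nat -> V -> W) : (forall n, continuous (F n)) ->
  (forall n z, `|z| < n%:R -> F n z = 0) ->
  continuous (fun z => \sum_(i < (Num.truncn `|z|).+1) F i z).
Proof.
move=> cF F0 z.
pose K := (Num.truncn (`|z| + 1)).+1.
have zK : `|z| + 1 < K%:R by exact: truncnS_gt.
rewrite /continuous_at (locally_finite_sum_stable F0 (K := K)); last first.
  by rewrite (lt_trans _ zK)// ltrDl.
apply: (cvg_trans (G := (fun w => \sum_(i < K) F i w) @ z)).
  apply: near_eq_cvg; near=> w.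
  rewrite (locally_finite_sum_stable F0 (K := K))//.
  apply: lt_trans zK; rewrite -ltrBlDl; apply: le_lt_trans (lerB_dist _ _) _.
  by rewrite distrC; near: w; exact: cvgr_dist_lt.
have := @continuous_big W 'I_K +%R 0 xpredT add_continuous V
  (index_enum _) (fun i => F i) (fun i _ => cF i).
by move=> /(_ z).
Unshelve. all: by end_near. Qed.

(** Multiplying g n by a function chi that is 1 on the unit ball about the n-th
centre and 0 outside the ball of radius 2 makes the supports disjoint, because
the centres are at distance at least 4 from each other, and locally finite,
because the centres go to infinity. *)
Lemma simultaneous_extension (R : realType) (e : nat -> R * R -> 'rV[R]_3)
    (g : nat -> 'rV[R]_3 -> 'rV[R]_3) :
  (forall n p, circle p -> `|e n p - const_mx (4 * n%:R)| <= 1) ->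
  (forall n, continuous (g n)) ->
  exists2 f : 'rV[R]_3 -> 'rV[R]_3, continuous f &
    forall n p, circle p -> f (e n p) = g n (e n p).
Proof.
move=> ev cg.
pose v n : 'rV[R]_3 := const_mx (4 * n%:R).
have vv m n z : m != n -> `|z - v m| <= 1 -> 2 <= `|z - v n|.
  move=> mn zm.
  have mn1 : 1 <= `|m%:R - n%:R| :> R.
    rewrite -[m%:R]/((m%:Z)%:~R) -[n%:R]/((n%:Z)%:~R) -intrB -intr_norm ler1z.
    by rewrite -gtz0_ge1 normr_gt0 subr_eq0.
  have : 4 <= `|v m - v n|.
    apply: le_trans (normr_coord_le _ 0); rewrite !mxE -mulrBr normrM.
    by rewrite normr_nat -[leLHS]mulr1 ler_pM2l.
  by have := ler_distD z (v m) (v n); rewrite (distrC (v m) z); lra.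
pose chi n z : R := Num.max 0 (Num.min 1 (2 - `|z - v n|)).
have chi1 n z : `|z - v n| <= 1 -> chi n z = 1.
  by move=> zn; rewrite /chi min_l ?max_r//; lra.
have chi0 n z : 2 <= `|z - v n| -> chi n z = 0.
  by move=> zn; rewrite /chi max_l// ge_min subr_le0 zn orbT.
pose F n z := chi n z *: g n z.
have F0 n z : `|z| < n%:R -> F n z = 0.
  move=> zn; rewrite /F chi0 ?scale0r//.
  have n1 : 1 <= n%:R :> R.
    by rewrite ler1n -(ltr0n R); exact: le_lt_trans zn.
  have : 4 * n%:R <= `|v n|.
    by have := normr_coord_le (v n) 0; rewrite mxE -natrM normr_nat.
  by have := lerB_dist (v n) z; rewrite (distrC z); lra.
have cF n : continuous (F n).
  have c2 : continuous (fun z => 2 - `|z - v n| : R^o).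
    apply: (@lipschitz_continuous _ _ _ _ 1) => a b.
    rewrite opprB addrC subrKA distrC mul1r.
    by rewrite (le_trans (ler_dist_dist _ _))// opprB subrKA.
  move=> z; apply: continuousZ; last exact: cg.
  apply: continuous_max; first exact: cst_continuous.
  by apply: continuous_min; [exact: cst_continuous|exact: c2].
exists (fun z => \sum_(i < (Num.truncn `|z|).+1) F i z).
  exact: locally_finite_sum_continuous.
move=> n p Cp; set z := e n p; have zn := ev n p Cp; rewrite -/z -/(v n) in zn.
pose K := ((Num.truncn `|z|).+1 + n.+1)%N.
have nK : (n < K)%N by rewrite /K addnS ltnS leq_addl.
rewrite (locally_finite_sum_stable F0 (K := K)); last first.
  by rewrite (lt_le_trans (truncnS_gt _))// ler_nat leq_addr.
rewrite (bigD1 (Ordinal nK))//= big1 ?addr0 => [|i ni].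
  by rewrite /F chi1// scale1r.
by rewrite /F chi0 ?scale0r//; apply: vv zn; rewrite eq_sym.
Qed.

Theorem theorem4p5 (R : realType) (phi : nat -> set (knot_data R))
    (phiK : forall n, (0 < n)%N -> oriented_tame_knot_types (phi n)) :
  exists (f : 'rV[R]_3 -> 'rV[R]_3) (k : knot_data R),
    [/\ continuous f,
        is_oriented_knot k /\ polygonal k,
        iteratively_injective f (knot_support k) &
        forall n, (0 < n)%N -> phi n (knot_image (iter n.-1 f) k)].
Proof.
have [e eP] := choice (fun n =>
  tame_knot_type_representative (const_mx (4 * n%:R)) (phiK n.+1 isT)).
have he n : circle_embedding (e n) by have [] := eP n.
have step n : exists gn, continuous gn /\
    forall p, circle p -> gn (e n p) = e n.+1 p.
  by have [gn ? ?] := extend_between_embeddings (he n) (he n.+1); exists gn.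
have [g gP] := choice step.
have ev n p : circle p -> `|e n p - const_mx (4 * n%:R)| <= 1.
  by have [_ _ _] := eP n; exact.
have [f cf fe] := simultaneous_extension ev (fun n => (gP n).1).
have iterE n : {in @circle R, iter n f \o e 0 =1 e n}.
  elim: n => [//|n IH] p Cp; have := IH p Cp; rewrite /= => ->.
  by rewrite inE in Cp; rewrite fe// (gP n).2.
have iter0 : forall n, knot_image (iter n f) (knot_of (e 0)) = knot_of (e n).
  by move=> n; rewrite knot_image_of; exact: knot_of_ext.
exists f, (knot_of (e 0)); split => //.
- by split; [apply/is_oriented_knotP; exists (e 0)|have [] := eP 0].
- move=> n _ _ /set_mem[p Cp <-] /set_mem[q Cq <-] epq.
  congr (e 0 _); have [[_ eI _] _ _] := he n.
  by apply: eI; rewrite ?inE// -[LHS]iterE ?inE// -[RHS]iterE ?inE.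
- by case=> // n _; rewrite iter0; have [] := eP n.
Qed.
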